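(* Let $\mathcal{C}=\{0,\ell e_n,2\ell e_n,\dots,k\ell e_n,w_1,\dots,w_n\}\subset\mathbb{Z}^n$ be a primitive near circuit, with associated data $p,\nu,\lambda_1,\dots,\lambda_\nu,N$. Let $g_1,\dots,g_n$ be generic real univariate polynomials of degree $k$. Consider the system $$x^{w_i}=g_i(x_n^\ell)\qquad\text{for } i=1,\dots,n \tag{S}$$ for $x=(x_1,\dots,x_n)\in(\mathbb{C}^* )^n$, and the univariate polynomial $$f(x_n)\ :=\ x_n^N\prod_{i=1}^p\bigl(g_i(x_n^\ell)\bigr)^{\lambda_i}-\prod_{i=p+1}^\nu\bigl(g_i(x_n^\ell)\bigr)^{\lambda_i}.$$ Then associating to a solution $x$ of (S) its $n$th coordinate $x_n$ gives a one-to-one correspondence between the solutions of (S) and the roots of $f$, which restricts to a bijection between the real solutions of (S) and the real roots of $f$.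
   Context: Near circuits: let $k,\ell\ge 1$ be integers, $e_n$ the $n$th standard basis vector, and $w_1,\dots,w_n\in\mathbb{Z}^n$ such that $\{0,\ell e_n,w_1,\dots,w_n\}$ spans $\mathbb{R}^n$ and no $w_i$ lies in $\mathbb{R}e_n$. The set $\mathcal{C}=\{0,\ell e_n,\dots,k\ell e_n,w_1,\dots,w_n\}$ is called a near circuit. It is primitive if the integer linear combinations of its elements give all of $\mathbb{Z}^n$. Associated data: write $w_i=v_i+l_ie_n$ with $0\ne v_i\in\mathbb{Z}^{n-1}$ (the first $n-1$ coordinates), $l_i\in\mathbb{Z}$. If $\mathcal{C}$ is primitive, $v_1,\dots,v_n$ generate $\mathbb{Z}^{n-1}$ and satisfy a linear relation with coprime integer coefficients, unique up to sign. Order the $w_i$ and choose the sign so that this relation is $\sum_{i=1}^p\lambda_iv_i=\sum_{i=p+1}^\nu\lambda_iv_i$ with $0\le p\le\nu\le n$, the $\lambda_i$ positive coprime integers, and $$N:=\sum_{i=p+1}^\nu\lambda_il_i-\sum_{i=1}^p\lambda_il_i\ \ge 0 .$$ Empty sums are $0$ and empty products are $1$. $x^w$ denotes the monomial with exponent vector $w$. Solutions of systems are always taken in $(\mathbb{C}^* )^n$, real solutions in $(\mathbb{R}^* )^n$. ''Generic'' means: for all tuples $(g_1,\dots,g_n)$ in some non-empty Zariski open subset of the space of tuples of real polynomials of degree $k$. *)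

(* Defs.v *)
From mathcomp Require Import all_boot all_order all_algebra.
From mathcomp Require Import classical_sets functions reals.
From mathcomp.real_closed Require Export complex.
From mathcomp Require Import mpoly.
Set Implicit Arguments.
Unset Strict Implicit.
Unset Printing Implicit Defensive.
Import Order.TTheory GRing.Theory Num.Theory.
Local Open Scope ring_scope.
Local Open Scope classical_set_scope.
Local Open Scope complex_scope.

(* The dimension is n = m.+1, so that Z^(n-1) is 'rV[int]_m; the coordinates
   are 0, ..., m and the last one has index ord_max. *)

Section NearCircuits.
Variable m : nat.
Local Notation n := m.+1.

Definition e_last (K : pzRingType) : 'rV[K]_n := delta_mx 0 ord_max.

Definition near_circuit_points (k l : nat) (w : 'I_n -> 'rV[int]_n) :
    seq 'rV[int]_n :=
  [seq e_last int *+ (j * l) | j <- iota 0 k.+1] ++ [seq w i | i <- enum 'I_n].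

Definition to_real (R : realType) (u : 'rV[int]_n) : 'rV[R]_n := map_mx intr u.

Definition is_near_circuit (R : realType) (k l : nat)
    (w : 'I_n -> 'rV[int]_n) : Prop :=
  [/\ (0 < k)%N, (0 < l)%N,
      span [seq to_real R u | u <-
              [:: 0%R, e_last int *+ l & [seq w i | i <- enum 'I_n]]%SEQ] = fullv
    & forall i, to_real R (w i) \notin <[e_last R]>%VS].

Definition is_primitive (k l : nat) (w : 'I_n -> 'rV[int]_n) : Prop :=
  forall u : 'rV[int]_n, inIntSpan (in_tuple (near_circuit_points k l w)) u.

Definition vpart (u : 'rV[int]_n) : 'rV[int]_m := col' ord_max u.
Definition lpart (u : 'rV[int]_n) : int := u 0 ord_max.

(* With 0-based indices, the ranges 1..p, p+1..nu of the relation become i < p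
   and p <= i < nu.  The values of lam at i >= nu are irrelevant.  As the gcd of
   the empty family is 0, coprimality forces nu > 0. *)
Definition associated_data (w : 'I_n -> 'rV[int]_n)
    (p nu : nat) (lam : 'I_n -> nat) (N : nat) : Prop :=
  [/\ (p <= nu <= n)%N,
      forall i : 'I_n, (i < nu)%N -> (0 < lam i)%N,
      (\big[gcdn/0]_(i < n | i < nu) lam i = 1)%N,
      \sum_(i < n | (i < p)%N) vpart (w i) *+ lam i
        = \sum_(i < n | (p <= i < nu)%N) vpart (w i) *+ lam i
    & N%:Z = \sum_(i < n | (p <= i < nu)%N) lpart (w i) *+ lam i
             - \sum_(i < n | (i < p)%N) lpart (w i) *+ lam i].

Definition monomial (K : fieldType) (x : 'rV[K]_n) (u : 'rV[int]_n) : K :=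
  \prod_(j < n) x 0 j ^ u 0 j.

Definition solutions (K : fieldType) (l : nat) (w : 'I_n -> 'rV[int]_n)
    (g : 'I_n -> {poly K}) : set 'rV[K]_n :=
  [set x : 'rV[K]_n | (forall j, x 0 j != 0) /\
           forall i, monomial x (w i) = (g i).[x 0 ord_max ^+ l]].

Definition eliminant (K : fieldType) (l p nu : nat) (lam : 'I_n -> nat) (N : nat)
    (g : 'I_n -> {poly K}) : {poly K} :=
  'X^N * \prod_(i < n | (i < p)%N) (g i \Po 'X^l) ^+ lam i
  - \prod_(i < n | (p <= i < nu)%N) (g i \Po 'X^l) ^+ lam i.

End NearCircuits.

Definition complexify (R : realType) (q : {poly R}) : {poly R[i]} :=
  map_poly (real_complex R) q.

Definition zariski_open (K : fieldType) (d : nat) (U : set 'rV[K]_d) : Prop :=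
  exists S : set {mpoly K[d]},
    U = ~` [set a : 'rV[K]_d | forall P, S P -> P.@[fun t => a 0 t] = 0].

Definition degree_tuple (K : fieldType) (n k : nat) (g : 'I_n -> {poly K}) : Prop :=
  forall i, size (g i) = k.+1.

Definition coefficients (K : fieldType) (n k : nat) (g : 'I_n -> {poly K}) :
    'rV[K]_(n * k.+1) :=
  mxvec (\matrix_(i < n, j < k.+1) (g i)`_j).

(* The space of n-tuples of polynomials of degree k carries the topology induced
   by its embedding in the affine space of coefficients; Q holds generically if
   it holds on a non-empty open subset of that space. *)
Definition generically (K : fieldType) (n k : nat)
    (Q : ('I_n -> {poly K}) -> Prop) : Prop :=
  exists U : set 'rV[K]_(n * k.+1),
    [/\ zariski_open U,
        exists g : 'I_n -> {poly K}, degree_tuple k g /\ U (coefficients k g)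
      & forall g : 'I_n -> {poly K},
          degree_tuple k g -> U (coefficients k g) -> Q g].

(* Main.v *)
(* Primitivity provides an integer matrix A and a column b with A W + b e_n = 1,
   where W has rows w_i, so a solution x of (S) with x_n = z must be
   x_j = prod_i c_i^(A_ji) * z^(b_j), where c_i = g_i(z^l). Conversely this point
   solves (S) as soon as every integer relation r W + s e_n = 0 gives c^r z^s = 1.
   Since the v_i span Q^(n-1) and the lambda_i are coprime, all these relations are
   multiples of a single one, and for that one the condition reads f(z) = 0,
   provided z and the c_i do not vanish.
   That proviso is where genericity enters: f(0) <> 0 excludes z = 0; two distinct
   g_i have no common root, which excludes c_i = 0 for i < nu, because then both
   products in f vanish, hence also c_j for some j <> i; and for i >= nu the polynomial f does not involve g_i, so
   that f and g_i(x^l) are generically coprime. The last two conditions are the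
   nonvanishing of resultants of polynomials with indeterminate coefficients. *)
Require Import Defs.
From mathcomp Require Import all_boot all_order all_algebra.
From mathcomp Require Import classical_sets functions reals.
From mathcomp Require Import mpoly.
Set Implicit Arguments.
Unset Strict Implicit.
Unset Printing Implicit Defensive.
Import Order.TTheory GRing.Theory Num.Theory.
Local Open Scope ring_scope.
Local Open Scope classical_set_scope.
Local Open Scope complex_scope.

(** * Nonzero values of polynomials in several variables *)

(** The leading monomial [m0] is determined by its last exponent together with the remaining
    exponents [m'], so no other monomial of [p] contributes to that coefficient of [muni p]. *)
Lemma muni_eq0 (R : nzRingType) n (p : {mpoly R[n.+1]}) : (muni p == 0) = (p == 0).
Proof.
apply/eqP/eqP => [|->]; last exact: muni0.
have [->//|p_neq0] := eqVneq p 0; pose m0 := mlead p.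
pose m' := [multinom m0 (widen_ord (leqnSn n) i) | i < n].
move=> /(congr1 (fun q : {poly {mpoly R[n]}} => mcoeff m' q`_(m0 ord_max))).
rewrite coef0 mcoeff0 muniE coef_sum raddf_sum /=.
rewrite (bigD1_seq m0) ?mlead_supp ?msupp_uniq //= big1 => [|m m_neq].
  rewrite coefZ coefXn eqxx mulr1 mcoeffZ mcoeffX eqxx mulr1 addr0 => /eqP.
  by rewrite mleadc_eq0 (negPf p_neq0).
rewrite coefZ coefXn mulr_natr mcoeffMn mcoeffZ mcoeffX.
have [m_max|] := eqVneq (m0 ord_max) (m ord_max); last by rewrite mulr0n.
have [/mnmP m_res|] := eqVneq; last by rewrite mulr0 mul0rn.
case/eqP: m_neq; apply/mnmP => i.
case: (unliftP ord_max i) => [j ->|-> //]; have := m_res j; rewrite !mnmE.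
by congr (m _ = m0 _); apply: val_inj; rewrite /= /bump leqNgt ltn_ord.
Qed.

Lemma meval_muni (R : comNzRingType) n (p : {mpoly R[n.+1]}) (v : 'I_n.+1 -> R) :
  p.@[v] =
    (map_poly (meval (fun i => v (widen_ord (leqnSn n) i))) (muni p)).[v ord_max].
Proof.
rewrite mevalE muniE rmorph_sum horner_sum; apply: eq_bigr => m _ /=.
rewrite map_polyZ /= map_polyXn hornerZ hornerXn mevalZ mevalX big_ord_recr /= mulrA.
by congr (_ * _ * _); apply: eq_bigr => i _; rewrite mnmE.
Qed.

(** The integers from 0 to [size p - 1] are distinct in [R], hence too numerous to be all roots. *)
Lemma poly_nonroot (R : numDomainType) (p : {poly R}) : p != 0 -> exists x, ~~ root p x.
Proof.
move=> p_neq0; pose rs := [seq i%:R : R | i <- iota 0 (size p)].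
have /allPn[x _ x_nonroot]: ~~ all (root p) rs.
  apply/negP => /(max_poly_roots p_neq0).
  rewrite size_map size_iota ltnn map_inj_uniq ?iota_uniq; first by move/(_ isT).
  by move=> i j /eqP; rewrite eqr_nat => /eqP.
by exists x.
Qed.

(** Induction on the number of variables: the leading coefficient in the last variable is nonzero at
    some [v], so specializing the other variables at [v] leaves a nonzero univariate polynomial,
    which has a nonroot. *)
Lemma meval_neq0 (R : numDomainType) n (p : {mpoly R[n]}) :
  p != 0 -> exists v, p.@[v] != 0.
Proof.
elim: n p => [|n IHn] p p_neq0.
  exists (fun _ => 0); rewrite mevalE; have := p_neq0.
  rewrite -mleadc_eq0; apply: contra_neq.
  rewrite (bigD1_seq (mlead p)) ?mlead_supp ?msupp_uniq //= big_ord0 mulr1.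
  rewrite big1 ?addr0 // => m /eqP[]; apply/mnmP; by case.
have := p_neq0; rewrite -muni_eq0 -lead_coef_eq0 => /IHn[v lead_v].
have [|x x_nonroot] := @poly_nonroot _ (map_poly (meval v) (muni p)).
  apply: contra_neq lead_v => /(congr1 (fun q : {poly R} => q`_(size (muni p)).-1)).
  by rewrite coef0 coef_map.
exists (fun i => oapp v x (unlift ord_max i)); rewrite meval_muni unlift_none /=.
rewrite (@eq_map_poly _ _ _ (meval v)) // => q; apply: meval_eq => i.
have -> : widen_ord (leqnSn n) i = lift ord_max i.
  by apply: val_inj; rewrite /= /bump leqNgt ltn_ord.
by rewrite liftK.
Qed.

(** * Resultants and coprimality, and the polynomial f over a commutative ring *)

(** As both sizes are preserved, the two Sylvester matrices have the same shape and [h] acts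
    entrywise. *)
Lemma rmorph_resultant (aR rR : nzRingType) (h : {rmorphism aR -> rR})
    (p q : {poly aR}) :
  size (map_poly h p) = size p -> size (map_poly h q) = size q ->
  h (resultant p q) = resultant (map_poly h p) (map_poly h q).
Proof.
move=> size_hp size_hq.
rewrite /resultant /Sylvester_mx size_hp size_hq.
rewrite -det_map_mx map_col_mx; congr (\det (col_mx _ _)); apply/matrixP => i j.
all: rewrite !mxE /= !rVpoly_delta !coefXnM coef_map.
all: by case: ifP; rewrite ?rmorph0.
Qed.

(** A single coprime specialization of full degree certifies that a resultant with indeterminate
    coefficients is not zero. *)
Lemma resultant_neq0 (aR : nzRingType) (rR : idomainType) (h : {rmorphism aR -> rR})
    (p q : {poly aR}) :
  size (map_poly h p) = size p -> size (map_poly h q) = size q ->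
  coprimep (map_poly h p) (map_poly h q) -> resultant p q != 0.
Proof.
move=> size_hp size_hq co_pq.
have: resultant (map_poly h p) (map_poly h q) != 0.
  by rewrite resultant_eq0 -leqNgt eq_leq //; apply/eqP.
by apply: contra_neq; rewrite -rmorph_resultant // => ->; rewrite rmorph0.
Qed.

(** The resultant is a combination of [p] and [q]; applying [h] gives a Bezout identity with a
    nonzero constant, even if [h] lowers degrees. *)
Lemma resultant_coprimep (aR : comNzRingType) (rR : fieldType)
    (h : {rmorphism aR -> rR}) (p q : {poly aR}) :
  (1 < size p)%N -> (1 < size q)%N -> h (resultant p q) != 0 ->
  coprimep (map_poly h p) (map_poly h q).
Proof.
move=> p_gt1 q_gt1 res_neq0.
have [[u v] /= _ /(congr1 (map_poly h))] := resultant_in_ideal p_gt1 q_gt1.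
rewrite map_polyC rmorphD !rmorphM /= => bezout.
apply/Bezout_coprimepP; exists (map_poly h u, map_poly h v).
by rewrite /= -bezout -size_poly_eq1 size_polyC res_neq0.
Qed.

(** Only finitely many real numbers have the form z^l with z a complex root of [f]. For any other
    real [c], the polynomials [f] and X^l - c have no common complex root. *)
Lemma coprimep_XsubC_exp_comp (R : rcfType) (f : {poly R}) (k l : nat) :
  f != 0 -> exists c : R, coprimep f (('X - c%:P) ^+ k \Po 'X^l).
Proof.
move=> f_neq0; pose fC := map_poly (real_complex R) f.
have fC_neq0 : fC != 0 by rewrite map_poly_eq0.
have [rs fC_rs] := closed_field_poly_normal fC.
have [|c c_nonroot] := @poly_nonroot R
  (\prod_(z <- rs | complex.Im (z ^+ l) == 0) ('X - (complex.Re (z ^+ l))%:P)).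
  by apply: monic_neq0; apply: monic_prod_XsubC.
exists c; rewrite rmorphXn /= coprimep_expr // comp_polyB comp_polyX comp_polyC.
rewrite -(coprimep_map (real_complex R)) rmorphB /= map_polyXn map_polyC /=.
apply: Pdiv.ClosedField.root_coprimep => z.
rewrite -/fC fC_rs rootZ ?lead_coef_eq0 // root_prod_XsubC => z_rs.
rewrite !hornerE subr_eq0; apply: contraNneq c_nonroot => zl.
rewrite (big_rem z z_rs) /= zl eqxx /=.
by rewrite rootM root_XsubC eqxx.
Qed.

(* [eliminant] over an arbitrary commutative ring: it is needed over the ring of
   polynomials in the coefficients of the [g i], which is not a field. *)
Definition elim_poly (A : comNzRingType) (n l p nu : nat) (lam : 'I_n -> nat)
    (N : nat) (g : 'I_n -> {poly A}) : {poly A} :=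
  'X^N * \prod_(i < n | (i < p)%N) (g i \Po 'X^l) ^+ lam i
  - \prod_(i < n | (p <= i < nu)%N) (g i \Po 'X^l) ^+ lam i.

Lemma map_elim_poly (A B : comNzRingType) (h : {rmorphism A -> B})
    (n l p nu : nat) (lam : 'I_n -> nat) (N : nat) (g : 'I_n -> {poly A}) :
  map_poly h (elim_poly l p nu lam N g) =
    elim_poly l p nu lam N (fun i => map_poly h (g i)).
Proof.
rewrite /elim_poly rmorphB rmorphM /= map_polyXn !rmorph_prod.
by congr (_ * _ - _); apply: eq_bigr => i _; rewrite rmorphXn /= map_comp_poly map_polyXn.
Qed.

Lemma eq_elim_poly (A : comNzRingType) (n l p nu : nat) (lam : 'I_n -> nat)
    (N : nat) (g g' : 'I_n -> {poly A}) :
  (p <= nu)%N -> (forall i : 'I_n, (i < nu)%N -> g i = g' i) ->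
  elim_poly l p nu lam N g = elim_poly l p nu lam N g'.
Proof.
move=> le_p_nu eq_g; congr (_ * _ - _); apply: eq_bigr => i.
  by move=> lt_ip; rewrite eq_g // (leq_trans lt_ip).
by case/andP=> _ /eq_g->.
Qed.

Lemma horner_elim_poly (A : comNzRingType) (n l p nu : nat) (lam : 'I_n -> nat)
    (N : nat) (g : 'I_n -> {poly A}) (z : A) :
  (elim_poly l p nu lam N g).[z] =
    z ^+ N * \prod_(i < n | (i < p)%N) (g i).[z ^+ l] ^+ lam i
    - \prod_(i < n | (p <= i < nu)%N) (g i).[z ^+ l] ^+ lam i.
Proof.
rewrite hornerD hornerN hornerM hornerXn !horner_prod.
by congr (_ * _ - _); apply: eq_bigr => i _; rewrite horner_exp horner_comp hornerXn.
Qed.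

Section GenericPolynomials.
Variables (R : realType) (n k : nat).

(** The indeterminates are numbered through [mxvec_index] to match [coefficients], so that
    evaluation at [coef_point g] gives back [g]. *)
Definition generic_poly (i : 'I_n) : {poly {mpoly R[n * k.+1]}} :=
  \poly_(j < k.+1) 'X_(mxvec_index i (inord j)).

Definition coef_point (g : 'I_n -> {poly R}) (t : 'I_(n * k.+1)) : R :=
  coefficients k g 0 t.

Lemma map_generic_poly (g : 'I_n -> {poly R}) (i : 'I_n) :
  (size (g i) <= k.+1)%N ->
  map_poly (meval (coef_point g)) (generic_poly i) = g i.
Proof.
move=> size_g; apply/polyP => j; rewrite coef_map coef_poly /=.
case: ltnP => [lt_jk|le_kj]; last by rewrite meval0 nth_default // (leq_trans size_g).
by rewrite mevalXU /coef_point /coefficients mxvecE mxE inordK.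
Qed.

Lemma size_map_generic_poly v i : (size (map_poly (meval v) (generic_poly i)) <= k.+1)%N.
Proof. exact: leq_trans (size_poly _ _) (size_poly _ _). Qed.

Lemma coef_point_specialization (v : 'I_(n * k.+1) -> R) :
  coef_point (fun i => map_poly (meval v) (generic_poly i)) =1 v.
Proof.
move=> t; case/mxvec_indexP: t => i j; rewrite /coef_point /coefficients mxvecE mxE.
by rewrite coef_map coef_poly ltn_ord /= mevalXU inord_val.
Qed.

Lemma size_generic_poly i : size (generic_poly i) = k.+1.
Proof.
apply: size_poly_eq; apply/eqP => /(congr1 (meval (fun=> 1))) /eqP.
by rewrite mevalXU meval0 oner_eq0.
Qed.

(** A stronger form of genericity, given by one polynomial inequation. It is stable under finite
    conjunction, since a product of nonzero polynomials is nonzero. *)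
Definition outside_hypersurface (Q : ('I_n -> {poly R}) -> Prop) : Prop :=
  exists2 P : {mpoly R[n * k.+1]}, P != 0 &
    forall g, degree_tuple k g -> P.@[coef_point g] != 0 -> Q g.

Lemma outside_hypersurface_and (Q Q' : ('I_n -> {poly R}) -> Prop) :
  outside_hypersurface Q -> outside_hypersurface Q' ->
  outside_hypersurface (fun g => Q g /\ Q' g).
Proof.
move=> [P P_neq0 PQ] [P' P'_neq0 PQ']; exists (P * P'); first exact: mulf_neq0.
by move=> g deg_g; rewrite mevalM mulf_eq0 negb_or => /andP[/PQ Qg /PQ' Q'g]; auto.
Qed.

Lemma outside_hypersurface_forall (I : finType) (Q : I -> ('I_n -> {poly R}) -> Prop) :
  (forall i, outside_hypersurface (Q i)) ->
  outside_hypersurface (fun g => forall i, Q i g).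
Proof.
move=> outQ.
suff outQs (s : seq I): outside_hypersurface (fun g => forall i, i \in s -> Q i g).
  have [P P_neq0 PQ] := outQs (enum I); exists P => // g deg_g Pg i.
  by apply: (PQ g) => //; rewrite mem_enum.
elim: s => [|i s [P P_neq0 PQ]]; first by exists 1; rewrite ?oner_eq0.
have [P' P'_neq0 PQ'] := outQ i; exists (P * P'); first exact: mulf_neq0.
move=> g deg_g; rewrite mevalM mulf_eq0 negb_or => /andP[Pg P'g] j.
by rewrite inE => /predU1P[->|]; [exact: PQ' | exact: PQ].
Qed.

Lemma outside_hypersurface_generically (Q : ('I_n -> {poly R}) -> Prop) :
  outside_hypersurface Q -> generically k Q.
Proof.
move=> [P P_neq0 PQ].
(* Where [L] does not vanish, every member of the tuple has exact degree [k]; a point where [L * P]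
   is nonzero thus yields the tuple that makes the open set nonempty. *)
pose L : {mpoly R[n * k.+1]} := \prod_(i < n) (generic_poly i)`_k.
have L_neq0 : L != 0.
  apply/prodf_neq0 => i _; have := lead_coef_eq0 (generic_poly i).
  by rewrite /lead_coef size_generic_poly -size_poly_eq0 size_generic_poly => ->.
exists (~` [set a | forall P', [set P]%classic P' -> P'.@[fun t => a 0 t] = 0])%classic.
split; first by exists [set P]%classic.
- have [v] := meval_neq0 (mulf_neq0 L_neq0 P_neq0).
  rewrite mevalM mulf_eq0 negb_or => /andP[Lv Pv].
  exists (fun i => map_poly (meval v) (generic_poly i)); split=> [i|/(_ P erefl)].
    rewrite size_map_poly_id0 ?size_generic_poly //.
    rewrite /lead_coef size_generic_poly; move: Lv.
    by rewrite rmorph_prod => /prodf_neq0/(_ i isT).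
  by rewrite (meval_eq _ (coef_point_specialization v)); apply/eqP.
- move=> g deg_g Ug; apply: PQ => //; apply/eqP => Pg; apply: Ug => _ ->; exact: Pg.
Qed.

Lemma meval_elim_generic_poly (l p nu : nat) (lam : 'I_n -> nat) (N : nat)
    (g : 'I_n -> {poly R}) :
  (forall i, size (g i) <= k.+1)%N ->
  map_poly (meval (coef_point g)) (elim_poly l p nu lam N generic_poly) =
    elim_poly l p nu lam N g.
Proof.
move=> size_g; rewrite map_elim_poly; congr (_ * _ - _); apply: eq_bigr => i _.
all: by rewrite map_generic_poly.
Qed.

Lemma meval_elim_at0 (l p nu : nat) (lam : 'I_n -> nat) (N : nat)
    (g : 'I_n -> {poly R}) :
  (forall i, size (g i) <= k.+1)%N ->
  (elim_poly l p nu lam N generic_poly).[0].@[coef_point g] =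
    (elim_poly l p nu lam N g).[0].
Proof.
by move=> size_g; rewrite -horner_map /= meval0 meval_elim_generic_poly.
Qed.

Lemma elim_at0_generic_neq0 (l p nu : nat) (lam : 'I_n -> nat) (N : nat) (i0 : 'I_n) :
  (0 < l)%N -> (i0 < nu)%N -> (0 < lam i0)%N ->
  (elim_poly l p nu lam N generic_poly).[0] != 0.
Proof.
(* The index [i0] occurs in exactly one of the two products. So at 0 one product is 2 ^ [lam i0] and
   the other is 1, and the first term is 0 when [N] is positive; the two terms differ in every
   case. *)
move=> l_gt0 i0_nu lam_gt0; pose g (i : 'I_n) : {poly R} := if i == i0 then 2%:P else 1.
have prod_g (Q : pred 'I_n) :
    \prod_(i | Q i) (g i).[0 ^+ l] ^+ lam i = if Q i0 then 2 ^+ lam i0 else 1.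
  have g1 i : i != i0 -> (g i).[0 ^+ l] ^+ lam i = 1.
    by rewrite /g => /negPf->; rewrite hornerC expr1n.
  case: ifP => [Qi0|Qi0F].
    rewrite (bigD1 i0) //= big1 ?mulr1 => [|i /andP[_ /g1]//].
    by rewrite /g eqxx hornerC.
  by rewrite big1 // => i Qi; apply: g1; apply: contraTneq Qi => ->; rewrite Qi0F.
have exp_neq1 : (2 : R) ^+ lam i0 != 1.
  by rewrite gt_eqF // exprn_egt1 ?ltr1n // -lt0n.
suff : (elim_poly l p nu lam N g).[0] != 0.
  apply: contra_neq => elim0.
  rewrite -meval_elim_at0 ?elim0 ?meval0 //.
  by move=> i; rewrite /g; case: ifP => _; rewrite size_polyC ?oner_eq0 ?(leq_trans (leq_b1 _)).
rewrite horner_elim_poly !prod_g i0_nu andbT expr0n subr_eq0.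
case: ltnP => _; case: (N == 0)%N; rewrite ?mul1r ?mul0r //.
- by rewrite eq_sym oner_eq0.
- by rewrite eq_sym.
- by rewrite eq_sym expf_neq0 // pnatr_eq0.
Qed.

Lemma outside_elim_at0 (l p nu : nat) (lam : 'I_n -> nat) (N : nat) (i0 : 'I_n) :
  (0 < l)%N -> (i0 < nu)%N -> (0 < lam i0)%N ->
  outside_hypersurface (fun g => (elim_poly l p nu lam N g).[0] != 0).
Proof.
move=> l_gt0 i0_nu lam_gt0; exists (elim_poly l p nu lam N generic_poly).[0].
  exact: elim_at0_generic_neq0 lam_gt0.
by move=> g deg_g; rewrite meval_elim_at0 // => i; rewrite deg_g.
Qed.

(** The resultant is nonzero because it is so for X^k and X^k - 1, whose difference is 1. *)
Lemma outside_coprime_pair (i j : 'I_n) : (0 < k)%N -> i != j ->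
  outside_hypersurface (fun g => coprimep (g i) (g j)).
Proof.
move=> k_gt0 neq_ij; exists (resultant (generic_poly i) (generic_poly j)); last first.
  move=> g deg_g /resultant_coprimep; rewrite !map_generic_poly ?deg_g //.
  by apply; rewrite size_generic_poly ltnS.
pose g (t : 'I_n) : {poly R} := if t == i then 'X^k else 'X^k - 1.
have gi : g i = 'X^k by rewrite /g eqxx.
have gj : g j = 'X^k - 1 by rewrite /g eq_sym (negPf neq_ij).
have size_gi : size (g i) = k.+1 by rewrite gi size_polyXn.
have size_gj : size (g j) = k.+1 by rewrite gj size_XnsubC.
apply: (@resultant_neq0 _ _ (meval (coef_point g))).
- by rewrite map_generic_poly ?size_generic_poly ?size_gi.
- by rewrite map_generic_poly ?size_generic_poly ?size_gj.
rewrite !map_generic_poly ?size_gi ?size_gj // gi gj.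
apply/Bezout_eq1_coprimepP; exists (1, -1) => /=.
by rewrite mul1r mulN1r opprB addrC subrK.
Qed.

(** The coefficients of [g i] are independent of f, so they can be chosen after f has been
    specialized; this shows that the resultant of the generic polynomials is nonzero. *)
Lemma outside_coprime_elim (l p nu : nat) (lam : 'I_n -> nat) (N : nat) (i0 i : 'I_n) :
  (0 < k)%N -> (0 < l)%N -> (p <= nu)%N -> (i0 < nu)%N -> (0 < lam i0)%N -> (nu <= i)%N ->
  outside_hypersurface (fun g => coprimep (elim_poly l p nu lam N g) (g i \Po 'X^l)).
Proof.
move=> k_gt0 l_gt0 le_p_nu i0_nu lam_gt0 le_nu_i.
pose F := elim_poly l p nu lam N generic_poly.
have F0_neq0 : F.[0] != 0 by exact: elim_at0_generic_neq0 lam_gt0.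
(* The resultant criterion needs positive degrees. If [F] is constant in x, its nonzero value
   already defines the hypersurface. *)
have [F_const|F_nonconst] := leqP (size F) 1.
  exists F.[0] => // g deg_g; rewrite -meval_elim_generic_poly => [|j]; last by rewrite deg_g.
  rewrite -/F (size1_polyC F_const) hornerC => F_g; rewrite map_polyC /=.
  by rewrite -[_%:P]mulr1 mul_polyC coprimepZl ?coprime1p.
pose G := generic_poly i \Po 'X^l.
(* [size_comp_poly] only gives the predecessor of the size; size 0 is excluded because [k * l] is
   positive. *)
have size_comp (A : idomainType) (q : {poly A}) : size q = k.+1 -> size (q \Po 'X^l) = (k * l).+1.
  move=> size_q; have := size_comp_poly q 'X^l; rewrite size_polyXn size_q /=.
  case: (size _) => [/esym/eqP|s /= ->//].
  by rewrite muln_eq0 !gtn_eqF.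
have size_G : size G = (k * l).+1 by rewrite size_comp ?size_generic_poly.
have map_G g : degree_tuple k g -> map_poly (meval (coef_point g)) G = g i \Po 'X^l.
  by move=> deg_g; rewrite map_comp_poly map_polyXn map_generic_poly ?deg_g.
exists (resultant F G); last first.
  move=> g deg_g /resultant_coprimep; rewrite map_G // meval_elim_generic_poly => [|j]; last by rewrite deg_g.
  by apply; rewrite // size_G ltnS muln_gt0 k_gt0.
have F_neq0 : F != 0 by rewrite -size_poly_gt0 ltnW.
(* At [v] the polynomial [F] keeps its degree, as the specialization of the resultant requires. *)
have [v lead_v] : exists v, (lead_coef F).@[v] != 0 by apply: meval_neq0; rewrite lead_coef_eq0.
have size_Fv := size_map_poly_id0 lead_v.
have [|c co_c] := @coprimep_XsubC_exp_comp R (map_poly (meval v) F) k l.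
  by rewrite -size_poly_gt0 size_Fv size_poly_gt0.
(* Changing [g i] does not change the specialization of [F], as [nu <= i]. *)
pose g j := if j == i then ('X - c%:P) ^+ k else map_poly (meval v) (generic_poly j).
have size_gi : size (g i) = k.+1 by rewrite /g eqxx size_exp_XsubC.
have Fg : map_poly (meval (coef_point g)) F = map_poly (meval v) F.
  rewrite meval_elim_generic_poly => [|j]; last first.
    by rewrite /g; case: eqP => _; rewrite ?size_exp_XsubC ?size_map_generic_poly.
  rewrite map_elim_poly; apply: eq_elim_poly => // j lt_j_nu.
  by rewrite /g; case: eqP => // ij; move: lt_j_nu; rewrite ij ltnNge le_nu_i.
have Gg : map_poly (meval (coef_point g)) G = ('X - c%:P) ^+ k \Po 'X^l.
  by rewrite map_comp_poly map_polyXn map_generic_poly ?size_gi // /g eqxx.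
apply: (@resultant_neq0 _ _ (meval (coef_point g))).
- by rewrite Fg size_Fv.
- by rewrite Gg size_G size_comp ?size_exp_XsubC.
- by rewrite Fg Gg.
Qed.

End GenericPolynomials.

(** * Monomials with integer exponents at points of the torus *)

Section Monomials.
Variables (m : nat) (K : fieldType) (x : 'rV[K]_m.+1).
Hypothesis x_neq0 : forall j, x 0 j != 0.

Lemma monomialD u v : monomial x (u + v) = monomial x u * monomial x v.
Proof. by rewrite -big_split; apply: eq_bigr => j _; rewrite mxE expfzDr. Qed.

Lemma monomial0 : monomial x 0 = 1.
Proof. by rewrite /monomial big1 // => j _; rewrite mxE expr0z. Qed.

Lemma monomialZ a u : monomial x (a *: u) = monomial x u ^ a.
Proof.
rewrite /monomial (big_morph (fun y => y ^ a) (fun y z => expfzMl y z a) (exp1rz _ a)).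
by apply: eq_bigr => j _; rewrite mxE exprz_exp mulrC.
Qed.

(** This turns an identity between integer matrices into a multiplicative identity between
    coordinates. *)
Lemma monomial_mulmx (r : 'rV[int]_m.+1) (M : 'M[int]_m.+1) :
  monomial x (r *m M) = monomial (\row_i monomial x (row i M)) r.
Proof.
rewrite mulmx_sum_row (big_morph (monomial x) monomialD monomial0).
by apply: eq_bigr => i _; rewrite monomialZ mxE.
Qed.

Lemma monomial_delta j : monomial x (delta_mx 0 j) = x 0 j.
Proof.
rewrite /monomial (bigD1 j) //= big1 => [|i /negPf neq_ij].
  by rewrite mxE !eqxx expr1z mulr1.
by rewrite mxE neq_ij andbF expr0z.
Qed.

Lemma monomial_neq0 u : monomial x u != 0.
Proof. by apply/prodf_neq0 => j _; rewrite expfz_neq0. Qed.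

End Monomials.

(** * Integer relations among the exponent vectors *)

(** The points on the last axis contribute only to the multiple [b] of e_n; their common factor [l]
    is absorbed in it. *)
Lemma near_circuit_span m (k l : nat) (w : 'I_m.+1 -> 'rV[int]_m.+1) u :
  inIntSpan (in_tuple (near_circuit_points k l w)) u ->
  exists (a : 'rV[int]_m.+1) (b : int), u = a *m (\matrix_i w i) + b *: e_last m int.
Proof.
case=> a ->; elim/big_ind: _ => [|v v' [c [b ->]] [c' [b' ->]]|i _].
- by exists 0, 0; rewrite mul0mx scale0r addr0.
- by exists (c + c'), (b + b'); rewrite mulmxDl scalerDl addrACA.
have : (near_circuit_points k l w)`_i \in near_circuit_points k l w.
  by rewrite mem_nth.
rewrite mem_cat => /orP[/mapP[j _ ->]|/mapP[j _ ->]].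
  exists 0, (a i * (j * l)%:Z); rewrite mul0mx add0r.
  by rewrite -scaler_int -scaler_nat natz intz scalerA.
exists (a i *: delta_mx 0 j), 0.
by rewrite scale0r addr0 -scalemxAl -rowE rowK -scaler_int intz.
Qed.

(** Row j of [A] and entry j of [b] express the standard basis vector e_j through the [w i] and
    e_n. *)
Lemma primitive_left_inverse m (k l : nat) (w : 'I_m.+1 -> 'rV[int]_m.+1) :
  is_primitive k l w ->
  exists (A : 'M[int]_m.+1) (b : 'cV[int]_m.+1),
    A *m (\matrix_i w i) + b *m e_last m int = 1%:M.
Proof.
move=> w_prim.
have /fin_all_exists[a /fin_all_exists[b ab]] (j : 'I_m.+1) :=
  near_circuit_span (w_prim (delta_mx 0 j)).
exists (\matrix_j a j), (\col_j b j); apply/row_matrixP => j.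
rewrite linearD /= !row_mul rowK row1 ab; congr (_ + _).
by apply/rowP => t; rewrite !mxE big_ord1 !mxE.
Qed.

Lemma mulmx_col' (R : pzRingType) m n q (M : 'M[R]_(m, n)) (P : 'M[R]_(n, q.+1)) j :
  M *m (col' j P : 'M_(n, q)) = col' j (M *m P).
Proof. by apply/matrixP => i t; rewrite !mxE; apply: eq_bigr => u _; rewrite mxE. Qed.

Lemma mul_row'_mx (R : pzRingType) m n q (M : 'M[R]_(m.+1, n)) (P : 'M[R]_(n, q)) i :
  (row' i M : 'M_(m, n)) *m P = row' i (M *m P).
Proof. by apply/matrixP => t j; rewrite !mxE; apply: eq_bigr => u _; rewrite mxE. Qed.

Definition relation_vector (n p nu : nat) (lam : 'I_n -> nat) : 'rV[int]_n :=
  \row_i (if (i < p)%N then (lam i)%:Z else if (i < nu)%N then - (lam i)%:Z else 0).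

Lemma sum_relation_vector (V : zmodType) (n p nu : nat) (lam : 'I_n -> nat) (v : 'I_n -> V) :
  \sum_i v i *~ relation_vector p nu lam 0 i =
    \sum_(i < n | (i < p)%N) v i *+ lam i - \sum_(i < n | (p <= i < nu)%N) v i *+ lam i.
Proof.
rewrite -sumrN [X in _ = X + _]big_mkcond [X in _ = _ + X]big_mkcond -big_split /=.
apply: eq_bigr => i _; rewrite mxE.
case: ltnP => _ /=; first by rewrite addr0 pmulrn.
by rewrite add0r; case: ifP => _; rewrite ?mulr0z // mulrNz pmulrn.
Qed.

(** The first coordinates cancel by the relation among the v_i; the last one is -N by the choice of
    sign in N. *)
Lemma relation_vector_mulmx m (w : 'I_m.+1 -> 'rV[int]_m.+1) p nu lam N :
  associated_data w p nu lam N ->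
  relation_vector p nu lam *m (\matrix_i w i) = - N%:Z *: e_last m int.
Proof.
move=> [_ _ _ v_rel l_rel].
have -> : relation_vector p nu lam *m (\matrix_i w i) =
    \sum_i w i *~ relation_vector p nu lam 0 i.
  by rewrite mulmx_sum_row; apply: eq_bigr => i _; rewrite rowK -scaler_int intz.
rewrite sum_relation_vector; apply/rowP => j; rewrite !mxE !summxE.
have entryE (Q : pred 'I_m.+1) :
    \sum_(i | Q i) (w i *+ lam i) 0 j = \sum_(i | Q i) w i 0 j *+ lam i.
  by apply: eq_bigr => i _; rewrite mulmxnE.
rewrite !entryE eqxx /=.
case: (unliftP ord_max j) => [j' ->|->].
  rewrite lift_eqF mulr0.
  have ventryE (Q : pred 'I_m.+1) : \sum_(i | Q i) (vpart (w i) *+ lam i) 0 j' =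
      \sum_(i | Q i) w i 0 (lift ord_max j') *+ lam i.
    by apply: eq_bigr => i _; rewrite mulmxnE mxE.
  by move/rowP/(_ j'): v_rel; rewrite !summxE !ventryE => ->; rewrite subrr.
by rewrite eqxx mulr1 l_rel opprB.
Qed.

Lemma relation_vector_primitive (n p nu : nat) (lam : 'I_n -> nat) (d : nat) :
  (p <= nu)%N -> (\big[gcdn/0]_(i < n | i < nu) lam i = 1)%N ->
  (forall i, (d %| `|relation_vector p nu lam 0%R i|)%N) -> d = 1%N.
Proof.
move=> le_p_nu gcd_lam dvd_d; apply/eqP; rewrite -dvdn1 -gcd_lam.
apply/dvdn_biggcdP => i lt_i_nu; have := dvd_d i; rewrite mxE lt_i_nu.
by case: ifP; rewrite ?abszN.
Qed.

(** With [a] in lowest terms, its denominator divides every entry of [mu] and therefore equals 1. *)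
Lemma proportional_int n (mu r : 'rV[int]_n) (a : rat) :
  (forall d, (forall i, (d %| `|mu 0%R i|)%N) -> d = 1%N) ->
  map_mx intr r = a *: map_mx intr mu -> exists t : int, r = t *: mu.
Proof.
move=> mu_prim r_mu; exists (numq a).
have eq_r i : denq a * r 0 i = numq a * mu 0 i.
  apply: (@intr_inj rat); move/rowP/(_ i): r_mu; rewrite !mxE !rmorphM /= => ->.
  by rewrite -[in a * _](divq_num_den a) mulrA mulrCA divff ?mulr1 // intr_eq0 denq_neq0.
have den1 : denq a = 1.
  have /mu_prim absz_den : forall i, (`|denq a| %| `|mu 0%R i|)%N.
    move=> i; rewrite -(@Gauss_dvdr _ `|numq a|) -?abszM -?eq_r ?abszM ?dvdn_mulr //.
    by rewrite coprime_sym coprime_num_den.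
  by rewrite -absz_denq absz_den.
by apply/rowP => i; rewrite mxE -eq_r den1 mul1r.
Qed.

(* The vectors [v_i] span Q^(n-1), so their relations form a line. *)
Lemma relation_multiple m (w : 'I_m.+1 -> 'rV[int]_m.+1) (p nu : nat) lam N
    (A : 'M[int]_m.+1) (b : 'cV[int]_m.+1) (r : 'rV[int]_m.+1) (s : int) :
  associated_data w p nu lam N ->
  A *m (\matrix_i w i) + b *m e_last m int = 1%:M ->
  r *m (\matrix_i w i) + s *: e_last m int = 0 ->
  exists t : int, r = t *: relation_vector p nu lam /\ s = t * N%:Z.
Proof.
move=> w_data AW rel; set W := \matrix_i w i; set mu := relation_vector p nu lam.
have muW : mu *m W = - N%:Z *: e_last m int by exact: relation_vector_mulmx w_data.
have [/andP[le_p_nu _] _ gcd_lam _ _] := w_data.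
pose V : 'M[rat]_(m.+1, m) := map_mx intr (col' ord_max W).
have in_ker (u : 'rV[int]_m.+1) (y : int) :
    u *m W = y *: e_last m int -> (map_mx intr u <= kermx V)%MS.
  move=> uW; apply/sub_kermxP; rewrite -map_mxM mulmx_col' uW.
  by apply/matrixP => i j; rewrite !mxE lift_eqF andbF mulr0.
(* Deleting the last row and column of [AW] kills the term in e_n, so [V] has a left inverse. *)
have rankV : \rank V = m.
  apply/eqP; rewrite eqn_leq rank_leq_col /=.
  apply: leq_trans (mxrankM_maxr (map_mx intr (row' ord_max A : 'M_(m, m.+1))) V).
  rewrite -map_mxM mul_row'_mx mulmx_col'.
  suff -> : row' ord_max (col' ord_max (A *m W)) = 1%:M by rewrite map_mx1 mxrank1.
  apply/matrixP => i j; rewrite !mxE; move/matrixP/(_ (lift ord_max i) (lift ord_max j)): AW.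
  rewrite [LHS]mxE [X in _ + X = _]mxE big_ord1 [e_last _ _ _ _]mxE.
  by rewrite eqxx lift_eqF mulr0 addr0 !mxE (inj_eq lift_inj).
have mu_neq0 : map_mx intr mu != 0 :> 'rV[rat]_m.+1.
  apply/eqP => /matrixP mu0.
  (* If [mu] were zero, 2 would divide all its entries. *)
  suff : 2%N = 1%N by [].
  apply: (relation_vector_primitive le_p_nu gcd_lam) => i.
  by have := mu0 0 i; rewrite [LHS]mxE [RHS]mxE => /eqP; rewrite intr_eq0 => /eqP->.
have mu_ker : (map_mx intr mu <= kermx V)%MS := in_ker _ _ muW.
(* The kernel has dimension (m + 1) - m = 1, so the nonzero vector [mu] spans it. *)
have ker_mu : (kermx V <= map_mx intr mu)%MS.
  rewrite -(geq_leqif (mxrank_leqif_sup mu_ker)) mxrank_ker rankV.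
  by rewrite subSnn lt0n mxrank_eq0.
have rW : r *m W = - s *: e_last m int by apply/eqP; rewrite scaleNr -addr_eq0 rel.
have /sub_rVP[a r_mu] := submx_trans (in_ker _ _ rW) ker_mu.
have [t r_t] := proportional_int (fun d => @relation_vector_primitive _ _ _ _ d le_p_nu gcd_lam) r_mu.
(* The last coordinates of the two expressions for [r *m W] give [s]. *)
exists t; split=> //; move: rW; rewrite r_t -scalemxAl muW scalerA.
move/rowP/(_ ord_max); rewrite !mxE !eqxx !mulr1 mulrN => /eqP.
by rewrite eqr_opp => /eqP.
Qed.

(** * Reconstruction of a solution from its last coordinate *)

Section Fibre.
Variables (m : nat) (w : 'I_m.+1 -> 'rV[int]_m.+1) (p nu : nat).
Variables (lam : 'I_m.+1 -> nat) (N : nat) (K : fieldType).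
Hypothesis w_data : associated_data w p nu lam N.

(** The negative entries of the relation vector put the second product in the denominator; it is
    nonzero, so clearing it gives the equation of f. *)
Lemma monomial_relation_vector (c : 'rV[K]_m.+1) (z : K) :
  (forall i, c 0 i != 0) ->
  (monomial c (relation_vector p nu lam) * z ^+ N == 1) =
    (z ^+ N * \prod_(i < m.+1 | (i < p)%N) c 0 i ^+ lam i ==
      \prod_(i < m.+1 | (p <= i < nu)%N) c 0 i ^+ lam i).
Proof.
move=> c_neq0.
have prod_neq0 : \prod_(i < m.+1 | (p <= i < nu)%N) c 0 i ^+ lam i != 0.
  by apply/prodf_neq0 => i _; rewrite expf_neq0.
have -> : monomial c (relation_vector p nu lam) =
    \prod_(i < m.+1 | (i < p)%N) c 0 i ^+ lam i /
    \prod_(i < m.+1 | (p <= i < nu)%N) c 0 i ^+ lam i.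
  rewrite -prodfV [X in _ = X * _]big_mkcond [X in _ = _ * X]big_mkcond -big_split /=.
  apply: eq_bigr => i _; rewrite mxE; case: ltnP => _ /=; first by rewrite mulr1.
  by case: ifP => _; rewrite mul1r ?expr0z // exprnN.
by rewrite -[LHS](inj_eq (mulIf prod_neq0)) mul1r mulrAC divfK // mulrC.
Qed.

Variables (A : 'M[int]_m.+1) (b : 'cV[int]_m.+1).
Hypothesis AW : A *m (\matrix_i w i) + b *m e_last m int = 1%:M.

(** On the torus this is a left inverse of the map sending x to its monomials x^(w_i) and its last
    coordinate. *)
Definition fibre_point (c : 'rV[K]_m.+1) (z : K) : 'rV[K]_m.+1 :=
  \row_j (monomial c (row j A) * z ^ b j 0).

Lemma solution_fibre_point (x : 'rV[K]_m.+1) : (forall j, x 0 j != 0) ->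
  x = fibre_point (\row_i monomial x (w i)) (x 0 ord_max).
Proof.
move=> x_neq0; apply/rowP => j; rewrite mxE -[LHS]monomial_delta //.
have -> : delta_mx 0 j = row j A *m (\matrix_i w i) + b j 0 *: e_last m int.
  rewrite -row1 -AW linearD /= !row_mul; congr (_ + _).
  by apply/rowP => t; rewrite !mxE big_ord1 !mxE.
rewrite monomialD // monomialZ monomial_delta // monomial_mulmx //.
by congr (monomial _ _ * _); apply/rowP => i; rewrite !mxE rowK.
Qed.

Lemma solution_relation (x : 'rV[K]_m.+1) : (forall j, x 0 j != 0) ->
  monomial (\row_i monomial x (w i)) (relation_vector p nu lam) * x 0 ord_max ^+ N = 1.
Proof.
move=> x_neq0.
have -> : \row_i monomial x (w i) = \row_i monomial x (row i (\matrix_i w i)).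
  by apply/rowP => i; rewrite !mxE rowK.
rewrite -monomial_mulmx // (relation_vector_mulmx w_data) monomialZ monomial_delta //.
by rewrite -exprnN mulVf // expf_neq0.
Qed.

Variables (c : 'rV[K]_m.+1) (z : K).
Hypotheses (c_neq0 : forall i, c 0 i != 0) (z_neq0 : z != 0).
Hypothesis cz : monomial c (relation_vector p nu lam) * z ^+ N = 1.

Lemma fibre_point_neq0 j : fibre_point c z 0 j != 0.
Proof. by rewrite mxE mulf_neq0 ?expfz_neq0 ?monomial_neq0. Qed.

(** By [relation_multiple] the left side is a power of the left side of [cz]. *)
Lemma relation_eq1 (r : 'rV[int]_m.+1) (s : int) :
  r *m (\matrix_i w i) + s *: e_last m int = 0 -> monomial c r * z ^ s = 1.
Proof.
move=> /(relation_multiple w_data AW)[t [-> ->]].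
by rewrite monomialZ // mulrC [t * _]mulrC -exprz_exp -expfzMl -exprnP mulrC cz exp1rz.
Qed.

Lemma monomial_fibre_point (u : 'rV[int]_m.+1) :
  monomial (fibre_point c z) u = monomial c (u *m A) * z ^ ((u *m b) 0 0).
Proof.
rewrite monomial_mulmx // [(u *m b) 0 0]mxE.
rewrite (big_morph (fun a => z ^ a) (fun s t => expfzDr s t z_neq0) (expr0z z)).
by rewrite -big_split; apply: eq_bigr => j _; rewrite !mxE expfzMl exprz_exp [b _ _ * _]mulrC.
Qed.

Lemma left_inverse_decomposition (u : 'rV[int]_m.+1) :
  u *m A *m (\matrix_i w i) + (u *m b) 0 0 *: e_last m int = u.
Proof.
rewrite -[RHS]mulmx1 -AW mulmxDr !mulmxA; congr (_ + _).
by apply/rowP => t; rewrite !mxE big_ord1 !mxE.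
Qed.

Lemma fibre_point_last : fibre_point c z 0 ord_max = z.
Proof.
rewrite -[LHS]monomial_delta monomial_fibre_point.
(* The decomposition of e_n through [A] and [b], minus e_n itself, is a relation. *)
set u := delta_mx 0 ord_max; have := @relation_eq1 (u *m A) ((u *m b) 0 0 - 1).
rewrite scalerBl scale1r addrA left_inverse_decomposition subrr => /(_ erefl).
rewrite expfzDr // mulrA => /(canRL (mulfK _)) -> //; last exact: expfz_neq0.
by rewrite mul1r invr_expz opprK expr1z.
Qed.

Lemma fibre_point_solution i : monomial (fibre_point c z) (w i) = c 0 i.
Proof.
rewrite monomial_fibre_point.
(* Here the relation is the decomposition of [w i] through [A] and [b], minus the trivial one. *)
have := @relation_eq1 (w i *m A - delta_mx 0 i) ((w i *m b) 0 0).
rewrite mulmxBl addrAC left_inverse_decomposition -rowE rowK subrr => /(_ erefl).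
rewrite monomialD // -scaleN1r monomialZ monomial_delta // mulrAC.
by move/(canRL (mulfK _)) => -> //; rewrite ?invr_expz ?opprK ?expr1z ?mul1r ?expfz_neq0.
Qed.

End Fibre.

(** * The genericity conditions combined, and the correspondence *)

Lemma outside_hypersurface_sub (R : realType) n k (Q Q' : ('I_n -> {poly R}) -> Prop) :
  (forall g, Q g -> Q' g) -> outside_hypersurface k Q -> outside_hypersurface k Q'.
Proof. by move=> QQ' [P P_neq0 PQ]; exists P => // g deg_g /PQ Qg; auto. Qed.

Lemma outside_hypersurface_imply (R : realType) n k (B : bool)
    (Q : ('I_n -> {poly R}) -> Prop) :
  (B -> outside_hypersurface k Q) -> outside_hypersurface k (fun g => B -> Q g).
Proof.
case: B => [/(_ isT)|_]; first by apply: outside_hypersurface_sub.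
by exists 1; rewrite ?oner_eq0.
Qed.

(** These conditions keep the roots of f away from 0 and from the zeros of the g_i(x^l). The second
    one concerns the [g i] themselves, since a common zero at z yields a common root z^l. *)
Definition separated (R : realType) (n l p nu : nat) (lam : 'I_n -> nat) (N : nat)
    (g : 'I_n -> {poly R}) : Prop :=
  [/\ (elim_poly l p nu lam N g).[0] != 0,
      forall i j, i != j -> coprimep (g i) (g j)
    & forall i : 'I_n, (nu <= i)%N -> coprimep (elim_poly l p nu lam N g) (g i \Po 'X^l)].

Lemma outside_hypersurface_separated (R : realType) (n k l p nu : nat)
    (lam : 'I_n -> nat) (N : nat) (i0 : 'I_n) :
  (0 < k)%N -> (0 < l)%N -> (p <= nu)%N -> (i0 < nu)%N -> (0 < lam i0)%N ->
  outside_hypersurface k (@separated R n l p nu lam N).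
Proof.
move=> k_gt0 l_gt0 le_p_nu i0_nu lam_gt0.
have out0 := @outside_elim_at0 R n k l p nu lam N i0 l_gt0 i0_nu lam_gt0.
have out1 : outside_hypersurface k
    (fun g : 'I_n -> {poly R} => forall i j, i != j -> coprimep (g i) (g j)).
  apply: outside_hypersurface_forall => i; apply: outside_hypersurface_forall => j.
  by apply: outside_hypersurface_imply => neq_ij; apply: outside_coprime_pair.
have out2 : outside_hypersurface k (fun g : 'I_n -> {poly R} => forall i : 'I_n,
    (nu <= i)%N -> coprimep (elim_poly l p nu lam N g) (g i \Po 'X^l)).
  apply: outside_hypersurface_forall => i; apply: outside_hypersurface_imply => le_nu_i.
  exact: outside_coprime_elim lam_gt0 le_nu_i.
apply: outside_hypersurface_sub (outside_hypersurface_and out0 (outside_hypersurface_and out1 out2)).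
by move=> g [? [? ?]].
Qed.

Lemma separated_root (R : realType) (n l p nu : nat) (lam : 'I_n -> nat) (N : nat)
    (g : 'I_n -> {poly R}) (z : R[i]) :
  (forall i : 'I_n, (i < nu)%N -> (0 < lam i)%N) -> separated l p nu lam N g ->
  root (elim_poly l p nu lam N (fun i => complexify (g i))) z ->
  z != 0 /\ forall i, (complexify (g i)).[z ^+ l] != 0.
Proof.
rewrite -map_elim_poly => lam_gt0 [f0_neq0 co_gg co_fg] fz.
have z_neq0 : z != 0.
  apply: contraTneq fz => ->.
  by rewrite /root horner_coef0 coef_map fmorph_eq0 -horner_coef0.
split=> // i; case: (leqP nu i) => [/co_fg|lt_i_nu].
  rewrite -(coprimep_map (real_complex R)) map_comp_poly map_polyXn.
  by move/coprimep_root/(_ fz); rewrite horner_comp hornerXn.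
(* For [i < nu] exactly one of the two products contains the vanishing factor. The other product,
   and z^N, are nonzero, which contradicts f(z) = 0. *)
apply/negP => gi0.
have no_common j : i != j -> (complexify (g j)).[z ^+ l] != 0.
  by move/co_gg; rewrite -(coprimep_map (real_complex R)) => /coprimep_root; apply.
have prod_eq0 (Q : pred 'I_n) : Q i ->
    \prod_(j | Q j) (complexify (g j)).[z ^+ l] ^+ lam j = 0.
  by move=> Qi; rewrite (bigD1 i) //= (eqP gi0) expr0n gtn_eqF ?lam_gt0 // mul0r.
have prod_neq0 (Q : pred 'I_n) : ~~ Q i ->
    \prod_(j | Q j) (complexify (g j)).[z ^+ l] ^+ lam j != 0.
  move=> nQi; apply/prodf_neq0 => j Qj; rewrite expf_neq0 // no_common //.
  by apply: contraNneq nQi => ->.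
move: fz; rewrite map_elim_poly /root horner_elim_poly subr_eq0.
have [lt_ip|le_pi] := ltnP i p.
  rewrite prod_eq0 // mulr0 eq_sym; apply/negP/prod_neq0.
  by rewrite negb_and -ltnNge lt_ip.
rewrite [X in _ == X]prod_eq0 ?le_pi //; apply/negP.
by rewrite mulf_neq0 ?expf_neq0 // prod_neq0 // -leqNgt.
Qed.

Theorem theorem3p2 (R : realType) (m k l : nat)
    (w : 'I_m.+1 -> 'rV[int]_m.+1)
    (p nu : nat) (lam : 'I_m.+1 -> nat) (N : nat) :
  is_near_circuit R k l w -> is_primitive k l w ->
  associated_data w p nu lam N ->
  generically k (fun g : 'I_m.+1 -> {poly R} =>
    let sols := solutions l w (fun i => complexify (g i)) in
    let f := complexify (eliminant l p nu lam N g) in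
    let last_coord := fun x : 'rV[R[i]]_m.+1 => x 0 ord_max in
    set_bij sols [set z : R[i] | root f z] last_coord /\
    set_bij (sols `&` [set x : 'rV[R[i]]_m.+1 | forall j, x 0 j \is Num.real])
            ([set z : R[i] | root f z] `&` [set z : R[i] | z \is Num.real]) last_coord).
Proof.
move=> [k_gt0 l_gt0 _ _] w_prim w_data.
have [A [b AW]] := primitive_left_inverse w_prim.
have [/andP[le_p_nu le_nu_n] lam_gt0 gcd_lam _ _] := w_data.
have nu_gt0 : (0 < nu)%N.
  by rewrite lt0n; apply/eqP => nu0; move: gcd_lam; rewrite nu0 big_pred0.
pose i0 : 'I_m.+1 := Ordinal (leq_trans nu_gt0 le_nu_n).
apply: outside_hypersurface_generically.
apply: outside_hypersurface_sub
  (@outside_hypersurface_separated R _ k l p nu lam N i0 k_gt0 l_gt0 le_p_nu nu_gt0 (lam_gt0 i0 nu_gt0)).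
move=> g g_sep sols f last_coord; pose gC i := complexify (g i).
pose c z : 'rV[R[i]]_m.+1 := \row_i (gC i).[z ^+ l].
have fE : f = elim_poly l p nu lam N gC := map_elim_poly _ _ _ _ _ _ _.
have rootE z : (forall i, c z 0 i != 0) ->
    root f z = (monomial (c z) (relation_vector p nu lam) * z ^+ N == 1).
  move=> c_neq0; rewrite monomial_relation_vector // fE /root.
  rewrite horner_elim_poly subr_eq0.
  by congr (_ * _ == _); apply: eq_bigr => i _; rewrite mxE.
have sol_c x : sols x -> \row_i monomial x (w i) = c (last_coord x).
  by move=> [_ x_sol]; apply/rowP => i; rewrite !mxE x_sol.
(* A solution is thus determined by its last coordinate; injectivity follows. *)
have sol_point x : sols x -> x = fibre_point A b (c (last_coord x)) (last_coord x).
  by move=> x_sol; rewrite -sol_c //; apply: solution_fibre_point; case: x_sol.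
have sol_root x : sols x -> root f (last_coord x).
  move=> x_sol; have [x_neq0 _] := x_sol.
  have c_neq0 i : c (last_coord x) 0 i != 0 by rewrite -sol_c // mxE monomial_neq0.
  by rewrite rootE // -sol_c // (solution_relation w_data).
have root_sol z : root f z ->
    sols (fibre_point A b (c z) z) /\ last_coord (fibre_point A b (c z) z) = z.
  move=> fz; have := fz; rewrite fE => /(separated_root lam_gt0 g_sep)[z_neq0 g_neq0].
  have c_neq0 i : c z 0 i != 0 by rewrite mxE; apply: g_neq0.
  have cz : monomial (c z) (relation_vector p nu lam) * z ^+ N = 1.
    by apply/eqP; rewrite -rootE.
  have lastE : last_coord (fibre_point A b (c z) z) = z.
    exact: (fibre_point_last w_data AW).
  split=> //; split=> [j|i]; first exact: fibre_point_neq0.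
  by rewrite (fibre_point_solution w_data AW) // mxE; congr (_.[_ ^+ l]).
(* The reconstruction involves only integer powers of [z] and of values of real polynomials, so it
   preserves reality. *)
have real_point z : z \is Num.real -> forall j, fibre_point A b (c z) z 0 j \is Num.real.
  move=> z_real j.
  have expz_real (y : R[i]) (a : int) : y \is Num.real -> y ^ a \is Num.real.
    by move=> y_real; case: a => a; rewrite ?rpredV rpredX.
  rewrite mxE rpredM ?expz_real // rpred_prod // => i _; rewrite expz_real // mxE.
  rewrite rpred_horner ?rpredX //; apply/polyOverP => t.
  by rewrite coef_map complex_real.
have inj : set_inj sols last_coord.
  move=> x y; rewrite !inE => /sol_point x_sol /sol_point y_sol xy.
  by rewrite x_sol y_sol xy.
split; split.
- exact: sol_root.
- exact: inj.
- by move=> z /root_sol[? ?]; exists (fibre_point A b (c z) z).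
- by move=> x [/sol_root fx x_real]; split; [exact: fx | exact: x_real].
- move=> x y; rewrite !inE => -[x_sol _] [y_sol _]; apply: inj; exact: mem_set.
- move=> z [/root_sol[? ?] z_real]; exists (fibre_point A b (c z) z) => //.
  by split=> //; apply: real_point.
Qed.
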